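(* Let $l\in\mathbb{Z}$ with $l\neq 0$, let $\alpha\in\mathbb{R}\setminus\mathbb{Q}$, and let $f\in\mathcal{F}_l$ have bounded variation on $[0,1]$. Let $T:\mathbb{T}^2\to\mathbb{T}^2$, $T(x,y)=(x+\alpha,f(x)+y)$. Then there exist $\epsilon_0>0$ and functions $c_1,c_2:(0,\epsilon_0)\to(0,+\infty)$ such that for every $\epsilon\in(0,\epsilon_0)$ $$c_1(\epsilon)\,n\le r(n,\epsilon)\le c_2(\epsilon)\,n\quad\text{for every integer } n\ge 1,$$ and $c_1(\epsilon)\to+\infty$ as $\epsilon\to 0$.
   Context: $\mathbb{T}^1=\mathbb{R}/\mathbb{Z}$ and $\mathbb{T}^2=\mathbb{T}^1\times\mathbb{T}^1$ carries the metric $d((x_1,y_1),(x_2,y_2))=\max\{\|x_1-x_2\|,\|y_1-y_2\|\}$, where $\|r-s\|=\min_{m\in\mathbb{Z}}|r-s+m|$. For $l\in\mathbb{Z}$, $\mathcal{F}_l=\{h:\mathbb{R}\to\mathbb{R}: h\text{ continuous and } h(x+1)-h(x)=l\text{ for all }x\in\mathbb{R}\}$; for $f\in\mathcal{F}_l$ the value $f(x)$ mod $1$ is well defined for $x\in\mathbb{T}^1$. For $n\ge1$ put $d_n(u,v)=\max_{0\le i\le n-1}d(T^iu,T^iv)$. A set $F\subset\mathbb{T}^2$ is $(n,\epsilon)$-spanning if for every $u\in\mathbb{T}^2$ there is $v\in F$ with $d_n(u,v)\le\epsilon$; $r(n,\epsilon)$ is the smallest cardinality of an $(n,\epsilon)$-spanning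 set (the topological complexity of $(\mathbb{T}^2,T)$). *)

(* Defs.v *)
From HB Require Import structures.
From mathcomp Require Import all_boot all_order all_algebra.
From mathcomp Require Import all_classical all_reals all_analysis.
From mathcomp Require Import ring.
Set Implicit Arguments.
Unset Strict Implicit.
Unset Printing Implicit Defensive.
Import Order.TTheory GRing.Theory Num.Theory.
Import numFieldNormedType.Exports.
Local Open Scope classical_set_scope.
Local Open Scope ring_scope.
Local Open Scope quotient_scope.

(* A named copy of [Num.int], to which the subgroup instance is attached. *)
Definition integers (R : realType) : {pred R} := Num.int.
Arguments integers R : clear implicits.

Fact integers_zmod_closed (R : realType) : zmod_closed (integers R).
Proof.
split; rewrite ?unfold_in; first exact: rpred0.
by move=> x y; rewrite !unfold_in; exact: rpredB.
Qed.

HB.instance Definition _ (R : realType) :=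
  GRing.isZmodClosed.Build R (integers R) (integers_zmod_closed R).

(* The additive group R/Z; [\pi_(circle R) x] is the class of [x] mod 1. *)
Definition circle (R : realType) : Type := Quotient.quot (integers R).

Definition torus (R : realType) : Type := (circle R * circle R)%type.

(* The infimum is a minimum, and does not depend on the representatives:
   see [circle_dist_pi]. *)
Definition circle_dist (R : realType) (x y : circle R) : R :=
  inf [set `|repr x - repr y + m%:~R| | m in [set: int]].

Definition torus_dist (R : realType) (u v : torus R) : R :=
  Num.max (circle_dist u.1 v.1) (circle_dist u.2 v.2).

(* The continuous lifts of the degree-[l] circle maps. *)
Definition lift_class (R : realType) (l : int) : set (R -> R) :=
  [set h : R -> R | continuous h /\ forall x, h (x + 1) - h x = l%:~R].

(* For [f] in [lift_class l] the choice of the representative of [u.1] is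
   irrelevant: see [skew_product_pi]. *)
Definition skew_product (R : realType) (alpha : R) (f : R -> R)
    (u : torus R) : torus R :=
  (u.1 + \pi_(circle R) alpha, \pi_(circle R) (f (repr u.1)) + u.2).

(* [torus_dist] is nonnegative, so for [1 <= n] the default value 0 does not
   affect the maximum. *)
Definition bowen_dist (R : realType) (T : torus R -> torus R) (n : nat)
    (u v : torus R) : R :=
  \big[Num.max/0]_(i < n) torus_dist (iter i T u) (iter i T v).

Definition spanning (R : realType) (T : torus R -> torus R) (n : nat)
    (eps : R) (F : set (torus R)) : Prop :=
  forall u : torus R, exists2 v, F v & bowen_dist T n u v <= eps.

(* Extended-real valued: it is +oo when there is no finite spanning set, and
   otherwise the smallest cardinality is attained (see [complexity_min]). *)
Definition complexity (R : realType) (T : torus R -> torus R) (n : nat)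
    (eps : R) : \bar R :=
  ereal_inf [set k%:R%:E | k in
    [set k : nat | exists2 F, spanning T n eps F & (F #= `I_k)%card]].

Lemma circle_eqP (R : realType) (x y : R) :
  reflect (exists m : int, x = y + m%:~R)
          (\pi_(circle R) x == \pi_(circle R) y).
Proof.
have -> : (\pi_(circle R) x == \pi_(circle R) y) = (x - y \is a Num.int).
  by rewrite -[LHS](@Quotient.idealrBE R (integers R)).
apply: (iffP (@intrP R (x - y))) => -[m e]; exists m.
  by rewrite -e addrC subrK.
by rewrite e addrC addKr.
Qed.

Lemma circle_piD (R : realType) (x y : R) :
  \pi_(circle R) (x + y) = \pi_(circle R) x + \pi_(circle R) y.
Proof. exact: (@Quotient.pi_add R (integers R) x y). Qed.

Lemma inf_int_dist (R : realType) (r : R) : exists m0 : int,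
  inf [set `|r + m%:~R| | m in [set: int]] = `|r + m0%:~R| /\
  forall m : int, `|r + m0%:~R| <= `|r + m%:~R|.
Proof.
suff [m0 hm0] : exists m0 : int, forall m : int, `|r + m0%:~R| <= `|r + m%:~R|.
  exists m0; split => //; apply/eqP; rewrite eq_le; apply/andP; split.
    apply: ge_inf; last by exists m0.
    by exists 0 => _ [m _ <-].
  apply: lb_le_inf; first by exists `|r + m0%:~R|, m0.
  by move=> _ [m _ <-].
have /andP[f1 f2] := floor_itv r.
set k := Num.floor r in f1 f2.
rewrite intrD in f2.
have key (m : int) :
    (r - k%:~R <= `|r + m%:~R|) || (k%:~R + 1 - r <= `|r + m%:~R|).
  have [h|h] := leP (- k) m; apply/orP.
    left; apply: le_trans (ler_norm _); rewrite lerD2l -intrN ler_int //.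
  right; rewrite -normrN; apply: le_trans (ler_norm _).
  rewrite opprD addrC lerD2l -intrN -[1]/(1%:~R) -intrD ler_int.
  by rewrite lerNr opprD lerBrDr lezD1.
have a1 : `|r + (- k)%:~R| = r - k%:~R.
  by rewrite intrN ger0_norm // subr_ge0.
have a2 : `|r + (- k - 1)%:~R| = k%:~R + 1 - r.
  rewrite intrB intrN -normrN ger0_norm.
    by rewrite opprD opprB addrC opprK (addrC 1).
  by rewrite opprD opprB opprK addrC subr_ge0 addrC ltW.
have [h|h] := leP (r - k%:~R) (k%:~R + 1 - r).
  exists (- k) => m; rewrite a1.
  by case/orP: (key m) => // /(le_trans h).
exists (- k - 1) => m; rewrite a2.
by case/orP: (key m) => // /(le_trans (ltW h)).
Qed.

Lemma circle_dist_pi (R : realType) (r s : R) : exists m0 : int,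
  circle_dist (\pi_(circle R) r) (\pi_(circle R) s) = `|r - s + m0%:~R| /\
  forall m : int, `|r - s + m0%:~R| <= `|r - s + m%:~R|.
Proof.
have [a ea] : exists m : int, repr (\pi_(circle R) r) = r + m%:~R.
  by apply/circle_eqP; rewrite reprK.
have [b eb] : exists m : int, repr (\pi_(circle R) s) = s + m%:~R.
  by apply/circle_eqP; rewrite reprK.
have [m0 [e h]] := inf_int_dist (r - s); exists m0; split => //.
rewrite -e /circle_dist; congr inf; apply/seteqP; split => _ [m _ <-].
  exists (a - b + m) => //; congr `|_|.
  by rewrite ea eb !intrD intrN; ring.
exists (m - a + b) => //; congr `|_|.
by rewrite ea eb !intrD intrN; ring.
Qed.

Lemma lift_class_int (R : realType) (l : int) (f : R -> R) :
  lift_class l f -> forall (m : int) x, f (x + m%:~R) = f x + (l * m)%:~R.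
Proof.
move=> [_ hf].
have fD1 x : f (x + 1) = f x + l%:~R by rewrite -(hf x) addrCA subrr addr0.
have fn (n : nat) x : f (x + n%:R) = f x + (l * n)%:~R.
  elim: n x => [|n IH] x; first by rewrite mulr0 !addr0.
  by rewrite -natr1 addrA fD1 IH -addrA -intrD -addn1 PoszD mulrDr mulr1.
case=> n x; first exact: fn.
rewrite NegzE intrN mulrN intrN.
by rewrite -{2}[x](subrK (n.+1)%:R) fn addrK.
Qed.

Lemma skew_product_pi (R : realType) (l : int) (alpha : R) (f : R -> R)
    (x y : R) : lift_class l f ->
  skew_product alpha f (\pi_(circle R) x, \pi_(circle R) y) =
  (\pi_(circle R) (x + alpha), \pi_(circle R) (f x + y)).
Proof.
move=> hf; rewrite /skew_product /=.
have [m em] : exists m : int, repr (\pi_(circle R) x) = x + m%:~R.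
  by apply/circle_eqP; rewrite reprK.
congr (_, _); first by rewrite circle_piD.
transitivity (\pi_(circle R) (f (repr (\pi_(circle R) x)) + y)).
  by rewrite circle_piD.
apply/eqP/circle_eqP; exists (l * m).
by rewrite em (lift_class_int hf) addrAC.
Qed.

Lemma complexity_min (R : realType) (T : torus R -> torus R) (n : nat)
    (eps : R) (F : set (torus R)) :
  finite_set F -> spanning T n eps F ->
  exists k : nat, [/\ complexity T n eps = k%:R%:E,
    exists2 G, spanning T n eps G & (G #= `I_k)%card &
    forall (j : nat) G, spanning T n eps G -> (G #= `I_j)%card -> (k <= j)%N].
Proof.
move=> [j0 Fj0] sF.
pose P k := `[< exists2 G, spanning T n eps G & (G #= `I_k)%card >].
have exP : exists k, P k by exists j0; apply/asboolP; exists F.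
have Pmin := ex_minnP exP; case: Pmin => k /asboolP Pk kmin.
have kle j G : spanning T n eps G -> (G #= `I_j)%card -> (k <= j)%N.
  by move=> sG cG; apply: kmin; apply/asboolP; exists G.
exists k; split => //.
apply/eqP; rewrite eq_le; apply/andP; split.
  by apply: ereal_inf_lbound; exists k.
apply: le_ereal_inf_tmp => _ [j [G sG cG] <-].
by rewrite lee_fin ler_nat (kle j G).
Qed.

(* Main.v *)
Require Import Defs.
From mathcomp Require Import all_boot all_order all_algebra.
From mathcomp Require Import all_classical all_reals all_analysis.
From mathcomp Require Import ring lra zify.
Set Implicit Arguments.
Unset Strict Implicit.
Unset Printing Implicit Defensive.
Import Order.TTheory GRing.Theory Num.Theory.
Import numFieldNormedType.Exports.
Local Open Scope classical_set_scope.
Local Open Scope ring_scope.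
Local Open Scope quotient_scope.

(** Over a point [x] the [n]-th iterate acts on the fibre as the translation by
    the Birkhoff sum [S_n(x) = f(x) + f(x + alpha) + ... + f(x + (n-1) alpha)],
    and [S_n] is a lift of a circle map of degree [l n].  The complexity is at
    most linear because the variation of [S_n] over a period is at most [n] times
    that of [f], and at least linear because a curve winding [l n] times around
    the fibre cannot be covered by fewer than about [n / eps] sets of diameter
    [eps].

    Upper bound.  Adding the identity to the total variation function of [f]
    gives [G] with [G(x + 1) = G(x) + A] whose increments dominate those of both
    [x] and [f] ([dominating_modulus]).  The increments of the single function
    [W = G(x) + G(x + alpha) + ... + G(x + (n-1) alpha)] then dominate those of
    every [S_i] with [i <= n] ([birkhoff_dominated]), while [W] grows by only
    [A n] over one period.  Cutting the range of [W] and the fibre into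
    intervals of length [eps / 2] cuts the torus into at most a constant times
    [n] sets of diameter at most [eps] for the distance [d_n]
    ([complexity_le_linear]).

    Lower bound.  Along the closed curve [x |-> (x, l x)] the last iterate
    [T^(n-1)] has the fibre coordinate [h(x) = S_(n-1)(x) + l x], which grows by
    exactly [l n] over one period.  If two points of the curve are shadowed by
    the same point of a spanning set, then their fibre coordinates agree up to
    [2 eps] modulo 1 at each time below [n].  The real difference of these
    coordinates starts small, and uniform continuity of [f] keeps it from
    jumping to a neighbourhood of another integer, so it is at most [2 eps] at
    the final time too ([curve_fiber_shadow]).  Hence points of the curve at
    which [h] takes the values [h(0) + l j / k], for [0 <= j < k n], need
    distinct shadowing points as soon as [2 eps k < 1], and the complexity is at
    least [k n] ([complexity_ge_linear]).  Taking [k] about [1 / (3 eps)] gives a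
    constant that tends to infinity. *)

(** * Distances, partitions and separated sets *)

Lemma circle_dist_leP (R : realType) (x y e : R) :
  circle_dist (\pi_(circle R) x) (\pi_(circle R) y) <= e <->
  exists m : int, `|x - y + m%:~R| <= e.
Proof.
have [m0 [-> hm]] := circle_dist_pi x y.
split=> [h|[m h]]; first by exists m0.
exact: le_trans (hm m) h.
Qed.

Lemma circle_dist_le (R : realType) (x y e : R) : `|x - y| <= e ->
  circle_dist (\pi_(circle R) x) (\pi_(circle R) y) <= e.
Proof. by move=> h; apply/circle_dist_leP; exists 0; rewrite addr0. Qed.

Lemma circle_dist_common (R : realType) (a b c : circle R) (e : R) :
  circle_dist a c <= e -> circle_dist b c <= e -> circle_dist a b <= 2 * e.
Proof.
rewrite -[a]reprK -[b]reprK -[c]reprK.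
move=> /circle_dist_leP[m hm] /circle_dist_leP[k hk].
apply/circle_dist_leP; exists (m - k).
rewrite (_ : _ + _ = (repr a - repr c + m%:~R) - (repr b - repr c + k%:~R));
  last by rewrite intrB; ring.
by apply: (le_trans (ler_normB _ _)); lra.
Qed.

Lemma bowen_dist_leP (R : realType) (T : torus R -> torus R) (n : nat)
    (u v : torus R) (e : R) : 0 <= e ->
  bowen_dist T n u v <= e <->
  forall i, (i < n)%N ->
    circle_dist (iter i T u).1 (iter i T v).1 <= e /\
    circle_dist (iter i T u).2 (iter i T v).2 <= e.
Proof.
move=> e0; rewrite /bowen_dist; split.
  move=> /bigmax_leP[_ h] i ni; have := h (Ordinal ni) isT.
  by rewrite /torus_dist ge_max => /andP.
move=> h; apply/bigmax_leP; split=> // i _.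
by rewrite /torus_dist ge_max; apply/andP; apply: h.
Qed.

(** One point taken in each nonempty class of the partition spans; a class that
    is empty contributes an arbitrary point, which does no harm to the count. *)
Lemma complexity_le_partition (R : realType) (T : torus R -> torus R) (n : nat)
    (eps : R) (K : finType) (b : torus R -> K) :
  (forall u v, b u = b v -> bowen_dist T n u v <= eps) ->
  (complexity T n eps <= #|K|%:R%:E)%E.
Proof.
move=> hb.
pose r (i : 'I_#|K|) : torus R := xget (0, 0) [set u | b u = enum_val i].
have leF : (r @` [set: 'I_#|K|] #<= `I_#|K|)%card.
  apply: card_le_trans (card_image_le _ _) _.
  by have /card_eqPle[_] := @card_II #|K|.
have [k Fk] : exists k, (r @` [set: 'I_#|K|] #= `I_k)%card.
  by apply/finite_setP/finite_set_leP; exists #|K|.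
apply: (@le_trans _ _ k%:R%:E); last first.
  by rewrite lee_fin ler_nat -card_le_II -(card_le_eql Fk).
apply: ereal_inf_lbound; exists k => //.
exists (r @` [set: 'I_#|K|]) => // u.
exists (r (enum_rank (b u))); first by exists (enum_rank (b u)).
apply: hb; rewrite /r enum_rankK.
by case: xgetP => [w _ /= ->|/(_ u)/=].
Qed.

(** Choosing a shadowing point for each [p i] defines an injection into any
    spanning set. *)
Lemma complexity_ge_separated (R : realType) (T : torus R -> torus R) (n : nat)
    (eps : R) (N : nat) (p : 'I_N -> torus R) :
  (forall i j v, bowen_dist T n (p i) v <= eps ->
    bowen_dist T n (p j) v <= eps -> i = j) ->
  (N%:R%:E <= complexity T n eps)%E.
Proof.
move=> sep; apply: le_ereal_inf_tmp => _ [k [F sF Fk] <-].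
rewrite lee_fin ler_nat -card_le_II -(card_le_eqr Fk).
rewrite -(card_le_eql (card_esym (@card_II N))).
have /choice[c hc] : forall i, exists v, F v /\ bowen_dist T n (p i) v <= eps.
  by move=> i; have [v Fv hv] := sF (p i); exists v.
have cinj : {in [set: 'I_N] &, injective c}.
  move=> i j _ _ cij; apply: (sep i j (c i)); first by rewrite (hc i).2.
  by rewrite cij (hc j).2.
rewrite -(card_le_eql (inj_card_eq cinj)).
by apply: subset_card_le => _ [i _ <-]; exact: (hc i).1.
Qed.

(** * Birkhoff sums *)

Definition birkhoff (R : realType) (g : R -> R) (alpha : R) (n : nat) (x : R) :=
  \sum_(k < n) g (x + k%:R * alpha).

Lemma birkhoffS (R : realType) (g : R -> R) (alpha : R) (n : nat) (x : R) :
  birkhoff g alpha n.+1 x = birkhoff g alpha n x + g (x + n%:R * alpha).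
Proof. by rewrite /birkhoff big_ord_recr. Qed.

Lemma birkhoff_lift (R : realType) (l : int) (f : R -> R) (alpha : R) (n : nat)
    (x : R) (m : int) : lift_class l f ->
  birkhoff f alpha n (x + m%:~R) = birkhoff f alpha n x + (l * m)%:~R * n%:R.
Proof.
move=> hf; elim: n => [|n IH]; first by rewrite /birkhoff !big_ord0 mulr0 addr0.
rewrite !birkhoffS IH (addrAC x) (lift_class_int hf) -natr1.
by ring.
Qed.

Lemma iter_skew_product (R : realType) (l : int) (alpha : R) (f : R -> R)
    (n : nat) (x y : R) : lift_class l f ->
  iter n (skew_product alpha f) (\pi_(circle R) x, \pi_(circle R) y) =
  (\pi_(circle R) (x + n%:R * alpha),
   \pi_(circle R) (birkhoff f alpha n x + y)).
Proof.
move=> hf; elim: n => [|n IH].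
  by rewrite /birkhoff big_ord0 add0r mul0r addr0.
rewrite iterS IH (skew_product_pi _ _ _ hf) birkhoffS; congr (\pi _, \pi _).
  by rewrite -natr1; ring.
by ring.
Qed.

(** Termwise domination bounds the increments of the first [i] terms, and the
    remaining terms of the sum of [G] can only add to its increments, since [G]
    is nondecreasing.  The absolute values make the statement symmetric in [x]
    and [y]. *)
Lemma birkhoff_dominated (R : realType) (g G : R -> R) (alpha : R) (i n : nat)
    (x y : R) :
  (forall a b, a <= b -> `|g b - g a| <= G b - G a) -> (i <= n)%N ->
  `|birkhoff g alpha i x - birkhoff g alpha i y| <=
  `|birkhoff G alpha n x - birkhoff G alpha n y|.
Proof.
move=> gG leq_in.
wlog xy : x y / x <= y.
  move=> H; have [/H//|/ltW/H] := leP x y.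
  by rewrite distrC (distrC _ (_ _ n y)).
rewrite distrC [leRHS]distrC; apply: le_trans (ler_norm _).
have step (k : nat) : `|g (y + k%:R * alpha) - g (x + k%:R * alpha)| <=
    G (y + k%:R * alpha) - G (x + k%:R * alpha) by apply: gG; rewrite lerD2r.
apply: (@le_trans _ _ (birkhoff G alpha i y - birkhoff G alpha i x)).
  rewrite /birkhoff -!sumrB; apply: le_trans (ler_norm_sum _ _ _) _.
  by apply: ler_sum => k _; exact: step.
elim: n leq_in => [|n IH]; first by rewrite leqn0 => /eqP ->.
rewrite leq_eqVlt ltnS => /predU1P[-> //|/IH h].
apply: le_trans h _; rewrite !birkhoffS.
by have := le_trans (normr_ge0 _) (step n); lra.
Qed.

(** * Upper bound *)

(** [G] is the identity plus [V], where [V] is the total variation of [f] from 0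
    to [x], continued from [0, 1] to the line by [V(x + 1) = V(x) + V(1)].  The
    increments of [V] dominate those of [f] also across integers, because [f]
    moves by [l] over a period and [|l| <= V(1)].  The identity is added so
    that the same function controls the base coordinate. *)
Lemma dominating_modulus (R : realType) (l : int) (f : R -> R) :
  lift_class l f -> bounded_variation 0 1 f ->
  exists (G : R -> R) (A : R),
    [/\ forall x y, x <= y -> y - x <= G y - G x,
        forall x y, x <= y -> `|f y - f x| <= G y - G x &
        forall x, G (x + 1) = G x + A].
Proof.
move=> hf bv.
have tvfin (x : R) : 0 <= x <= 1 -> total_variation 0 x f \is a fin_num.
  move=> /andP[x0 x1]; apply/bounded_variationP => //.
  exact: bounded_variationl bv.
pose v (x : R) := fine (total_variation 0 x f).
pose fl (x : R) : R := (Num.floor x)%:~R.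
have vD (x y : R) : 0 <= x -> x <= y -> y <= 1 -> `|f y - f x| <= v y - v x.
  move=> x0 xy y1.
  have fx : total_variation 0 x f \is a fin_num by apply: tvfin; lra.
  have fy : total_variation 0 y f \is a fin_num by apply: tvfin; lra.
  rewrite -lee_fin EFinB /v !fineK // (total_variationD f x0 xy) addeAC.
  rewrite subee // add0e; exact: total_variation_ge.
have v0 : v 0 = 0 by rewrite /v total_variationxx.
pose V (x : R) := v (x - fl x) + fl x * v 1.
have flP (x : R) : 0 <= x - fl x /\ x - fl x < 1.
  by have /andP[] := floor_itv x; rewrite intrD /fl; split; lra.
have fI (x : R) (m : int) : f (x + m%:~R) = f x + l%:~R * m%:~R.
  by rewrite (lift_class_int hf) intrM.
have ffl (x : R) : f x = f (x - fl x) + l%:~R * fl x.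
  by rewrite -fI subrK.
have lv : `|l%:~R| <= v 1.
  have := vD 0 1; rewrite v0 subr0 lexx !ler01 => /(_ isT isT (lexx _)).
  by have := fI 0 1; rewrite add0r mulr1 => ->; rewrite addrAC subrr add0r.
have VD (x y : R) : x <= y -> `|f y - f x| <= V y - V x.
  move=> xy; rewrite (ffl x) (ffl y) /V.
  have [x0 x1] := flP x; have [y0 y1] := flP y.
  have [e|ne] := eqVneq (Num.floor x) (Num.floor y).
    have e' : fl x = fl y by rewrite /fl e.
    rewrite e' in x0 x1 *.
    have := vD (x - fl y) (y - fl y) x0 _ (ltW y1); rewrite lerD2r => /(_ xy).
    set a := f (x - _); set b := f (y - _).
    rewrite (_ : b + _ - _ = b - a); last by ring.
    by lra.
  (* Go from [x] up to the next integer, then by whole periods to the integer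
     part of [y], then to [y]. *)
  have fle : fl x + 1 <= fl y.
    rewrite /fl -intrD1 ler_int -ltzD1 ltrD2r lt_neqAle ne.
    exact: le_floor.
  have h1 := vD _ _ x0 (ltW x1) (lexx 1).
  have h2 := vD _ _ (lexx 0) y0 (ltW y1).
  have e1 : f 1 = f 0 + l%:~R by rewrite -[1 in LHS]add0r (fI 0 1) mulr1.
  rewrite v0 subr0 in h2; rewrite e1 in h1.
  have h3 : `|l%:~R * (fl y - fl x - 1)| <= v 1 * (fl y - fl x - 1).
    rewrite normrM (@ger0_norm _ (fl y - fl x - 1)); last lra.
    by apply: ler_wpM2r => //; lra.
  move: h1 h2 h3; set a := f (x - _); set b := f (y - _).
  set c := v (x - _); set d := v (y - _).
  move: {e1} (f 0) (v 1) (l%:~R : R) (fl x) (fl y) => z w L p q h1 h2 h3.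
  have := ler_normD (z + L - a) (L * (q - p - 1)).
  have := ler_normD (z + L - a + L * (q - p - 1)) (b - z).
  rewrite (_ : z + L - a + L * (q - p - 1) + (b - z) =
               b + L * q - (a + L * p)); last by ring.
  by move: h1 h2 h3; lra.
exists (fun x => x + V x), (1 + v 1); split.
- by move=> x y xy; have := VD x y xy; have := normr_ge0 (f y - f x); lra.
- by move=> x y xy; have := VD x y xy; lra.
- move=> x; have e : fl (x + 1) = fl x + 1.
    by rewrite /fl -[1 in LHS]/(1%:~R) floorDrz ?intr_int // floor1 intrD.
  rewrite /V e (_ : x + 1 - (fl x + 1) = x - fl x); last by ring.
  by ring.
Qed.

Lemma circle_repr01 (R : realType) (c : circle R) :
  exists x : R, c = \pi_(circle R) x /\ 0 <= x < 1.
Proof.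
exists (repr c - (Num.floor (repr c))%:~R); split.
  rewrite -[LHS]reprK; apply/eqP/circle_eqP; exists (Num.floor (repr c)).
  by rewrite subrK.
have /andP[] := floor_itv (repr c); rewrite intrD => h1 h2.
by apply/andP; split; lra.
Qed.

(** The identity is its own Birkhoff sum of length 1, so for [1 <= n] the sum of
    [G] bounds the distance of the base points as well. *)
Lemma bowen_dist_le_dominated (R : realType) (l : int) (alpha : R) (f G : R -> R)
    (n : nat) (eps x y x' y' : R) :
  lift_class l f ->
  (forall a b, a <= b -> b - a <= G b - G a) ->
  (forall a b, a <= b -> `|f b - f a| <= G b - G a) ->
  (1 <= n)%N ->
  `|birkhoff G alpha n x - birkhoff G alpha n x'| <= eps / 2 ->
  `|y - y'| <= eps / 2 ->
  bowen_dist (skew_product alpha f) n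
    (\pi_(circle R) x, \pi_(circle R) y) (\pi_(circle R) x', \pi_(circle R) y')
    <= eps.
Proof.
move=> hf Gid Gf n1 hW hy.
have e0 : 0 <= eps by have := normr_ge0 (y - y'); lra.
have idG a b : a <= b -> `|id b - id a| <= G b - G a.
  by move=> ab; rewrite ger0_norm ?subr_ge0 // Gid.
have hx : `|x - x'| <= eps / 2.
  have := birkhoff_dominated alpha x x' idG n1.
  rewrite /birkhoff !big_ord1 mul0r !addr0 => h; exact: le_trans h hW.
apply/(bowen_dist_leP _ _ _ _ e0) => i ltin.
rewrite !(iter_skew_product _ _ _ _ hf) /=; split; apply: circle_dist_le.
  rewrite (_ : _ - _ = x - x'); last by ring.
  by lra.
have := birkhoff_dominated alpha x x' Gf (ltnW ltin) => hi.
set p := birkhoff f _ _ _; set q := birkhoff f _ _ _.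
rewrite (_ : _ - _ = (p - q) + (y - y')); last by ring.
by apply: le_trans (ler_normD _ _) _; lra.
Qed.

Lemma truncn_eq_dist (R : realType) (a b d : R) : 0 < d -> 0 <= a -> 0 <= b ->
  Num.truncn (a / d) = Num.truncn (b / d) -> `|a - b| <= d.
Proof.
move=> d0 a0 b0 e.
have /truncn_itv : 0 <= a / d by rewrite divr_ge0 // ltW.
have /truncn_itv : 0 <= b / d by rewrite divr_ge0 // ltW.
rewrite e -natr1 !ler_pdivlMr // !ltr_pdivrMr // => /andP[h1 h2] /andP[h3 h4].
by rewrite ler_norml; apply/andP; split; lra.
Qed.

Lemma complexity_le_linear (R : realType) (l : int) (alpha : R) (f G : R -> R)
    (A : R) (n : nat) (eps : R) :
  lift_class l f ->
  (forall x y, x <= y -> y - x <= G y - G x) ->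
  (forall x y, x <= y -> `|f y - f x| <= G y - G x) ->
  (forall x, G (x + 1) = G x + A) -> (1 <= n)%N -> 0 < eps ->
  (complexity (skew_product alpha f) n eps <=
   ((A / (eps / 2) + 1) * (1 / (eps / 2) + 1) * n%:R)%:E)%E.
Proof.
move=> hf Gid Gf GA n1 e0.
(* [G] grows by [A] over a period, and at least as fast as the identity. *)
have A1 : 1 <= A by have := Gid 0 (0 + 1); rewrite GA ler_wpDr //; lra.
have nR : 1 <= n%:R :> R by rewrite ler1n.
have d0 : 0 < eps / 2 by lra.
have [xr hxr] := choice (@circle_repr01 R).
pose W := birkhoff G alpha n.
have WA : W 1 = W 0 + A * n%:R.
  rewrite /W /birkhoff -[n in A * n%:R]card_ord -sum1_card natr_sum mulr_sumr.
  rewrite -big_split; apply: eq_bigr => k _ /=.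
  by rewrite mulr1 -GA addrAC add0r addrC.
have Wmono x y : x <= y -> W x <= W y.
  move=> xy; rewrite /W /birkhoff; apply: ler_sum => k _.
  have := Gid (x + k%:R * alpha) (y + k%:R * alpha).
  by rewrite lerD2r => /(_ xy); lra.
have Wge c : 0 <= W (xr c) - W 0.
  by have [_ /andP[h _]] := hxr c; have := Wmono _ _ h; lra.
have Wle c : W (xr c) - W 0 <= A * n%:R.
  by have [_ /andP[_ /ltW h]] := hxr c; have := Wmono _ _ h; lra.
pose M := Num.truncn (A * n%:R / (eps / 2)).
pose P := Num.truncn (1 / (eps / 2)).
pose binx c := Num.truncn ((W (xr c) - W 0) / (eps / 2)).
pose biny c := Num.truncn (xr c / (eps / 2)).
have binxM c : (binx c < M.+1)%N.
  by rewrite ltnS; apply: le_truncn; rewrite ler_pM2r ?invr_gt0.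
have binyP c : (biny c < P.+1)%N.
  rewrite ltnS; apply: le_truncn; rewrite ler_pM2r ?invr_gt0 //.
  by have [_ /andP[_ /ltW]] := hxr c.
apply: (@le_trans _ _ (#|{: 'I_M.+1 * 'I_P.+1}|%:R)%:E).
  apply: (@complexity_le_partition _ _ _ _ _
    (fun u => (Ordinal (binxM u.1), Ordinal (binyP u.2)))).
  move=> [u1 u2] [v1 v2] /= [e1 e2].
  have [-> _] := hxr u1; have [eu2 /andP[u20 _]] := hxr u2.
  have [-> _] := hxr v1; have [ev2 /andP[v20 _]] := hxr v2.
  rewrite eu2 ev2; apply: (bowen_dist_le_dominated hf Gid Gf n1).
    rewrite -!/(W _).
    have := truncn_eq_dist d0 (Wge u1) (Wge v1) e1.
    by rewrite (_ : _ - _ - _ = W (xr u1) - W (xr v1)) //; ring.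
  exact: truncn_eq_dist d0 u20 v20 e2.
rewrite lee_fin card_prod !card_ord natrM -[M.+1%:R]natr1 -[P.+1%:R]natr1.
have hM : M%:R <= A * n%:R / (eps / 2).
  by rewrite truncn_le divr_ge0 ?mulr_ge0 //; lra.
have hP : P%:R <= 1 / (eps / 2) by rewrite truncn_le divr_ge0 //; lra.
rewrite mulrAC; apply: ler_pM.
- by rewrite addr_ge0.
- by rewrite addr_ge0.
- by rewrite mulrDl mul1r [A / _ * _]mulrAC; apply: lerD.
- by rewrite lerD2r.
Qed.

(** * Lower bound *)

(** Compactness gives a modulus valid at the points of [0, 1], and translation
    by an integer changes [f x] and [f y] by the same amount. *)
Lemma lift_unif_continuous (R : realType) (l : int) (f : R -> R) (e : R) :
  lift_class l f -> 0 < e ->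
  exists2 d, 0 < d & forall x y, `|x - y| <= d -> `|f x - f y| <= e.
Proof.
move=> hf e0; have [fc _] := hf.
have /compact_near_coveringP cov := @segment_compact R 0 1.
have : \forall d \near 0^'+, `[0, 1] `<=`
    (fun x => forall y, `|x - y| <= d -> `|f x - f y| <= e).
  apply: cov => x _.
  have e20 : 0 < e / 2 by rewrite divr_gt0.
  have /cvgrPdist_le/(_ (e / 2) e20)[r /= r0 hr] := fc x.
  have r20 : 0 < r / 2 by rewrite divr_gt0.
  near=> z d => y /= zyd.
  have hxz : `|x - z| < r / 2 by near: z; exact: nbhsx_ballx.
  have hd : d <= r / 2 by near: d; exact: nbhs_right_le.
  have hz : `|f x - f z| <= e / 2 by apply: hr => /=; lra.
  have hy : `|f x - f y| <= e / 2.
    apply: hr => /=; rewrite (_ : x - y = (x - z) + (z - y)); last by ring.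
    by apply: le_lt_trans (ler_normD _ _) _; lra.
  rewrite (_ : f z - f y = (f x - f y) - (f x - f z)); last by ring.
  by apply: le_trans (ler_normB _ _) _; lra.
move=> [r /= r0 hr].
have r20 : 0 < r / 2 by rewrite divr_gt0.
exists (r / 2) => // x y hxy.
have hd := hr (r / 2) _ r20 (x + (- Num.floor x)%:~R) _
  (y + (- Num.floor x)%:~R).
have /andP[x0 x1] := floor_itv x; rewrite intrD in x1.
have subDD (a b c : R) : a + c - (b + c) = a - b by ring.
move: hd; rewrite !(lift_class_int hf) !subDD; apply => //=.
- by rewrite sub0r normrN gtr0_norm //; lra.
- by rewrite in_itv /= intrN; lra.
Unshelve. all: by end_near. Qed.

Lemma normr_int_lt1 (R : realType) (m : int) : `|m%:~R : R| < 1 -> m = 0.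
Proof. by rewrite -intr_norm -[ltRHS]/(1%:~R) ltr_int; lia. Qed.

(** A lift of the fibre coordinate of [T^n (x, l x)].  The slope [l] of the curve
    makes the growth over a period [l (n + 1)] instead of [l n], so that the
    count of separated points is right already for orbits of length 1. *)
Definition curve_fiber (R : realType) (l : int) (f : R -> R) (alpha : R)
    (n : nat) (x : R) : R := birkhoff f alpha n x + l%:~R * x.

Lemma curve_fiberS (R : realType) (l : int) (f : R -> R) (alpha : R) (n : nat)
    (x : R) :
  curve_fiber l f alpha n.+1 x = curve_fiber l f alpha n x + f (x + n%:R * alpha).
Proof. by rewrite /curve_fiber birkhoffS addrAC. Qed.

Lemma curve_fiber_lift (R : realType) (l : int) (f : R -> R) (alpha : R)
    (n : nat) (x : R) (m : int) : lift_class l f ->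
  curve_fiber l f alpha n (x + m%:~R) =
  curve_fiber l f alpha n x + (l * m * n.+1)%:~R.
Proof.
move=> hf; rewrite /curve_fiber (birkhoff_lift _ _ _ _ hf).
have -> : (l * m * n.+1)%:~R = l%:~R * m%:~R * (n%:R + 1) :> R.
  by rewrite !intrM natr1.
by rewrite intrM; ring.
Qed.

Lemma continuous_curve_fiber (R : realType) (l : int) (f : R -> R) (alpha : R)
    (n : nat) : continuous f -> continuous (curve_fiber l f alpha n).
Proof.
move=> fc; elim: n => [|n IH] x.
  rewrite (_ : curve_fiber l f alpha 0 = fun x => l%:~R * x).
    by apply: cvgMr; exact: cvg_id.
  by apply/funext => y; rewrite /curve_fiber /birkhoff big_ord0 add0r.
rewrite (_ : curve_fiber l f alpha n.+1 =
  curve_fiber l f alpha n \+ (fun x => f (x + n%:R * alpha))).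
  apply: cvgD; first exact: IH.
  apply: (@continuous_comp _ _ _ (fun x => x + n%:R * alpha) f); last exact: fc.
  by apply: cvgD; [exact: cvg_id|exact: cvg_cst].
by apply/funext => y; rewrite curve_fiberS.
Qed.

(** The difference of the fibre coordinates is within [d] of an integer at each
    time and moves by at most [1/4] in one step; as [d + 1/4 + d < 1], that
    integer is 0 as long as it was 0 one step before. *)
Lemma curve_fiber_shadow (R : realType) (l : int) (f : R -> R) (alpha d : R)
    (n : nat) (x x' : R) :
  (forall a b, `|a - b| <= d -> `|f a - f b| <= 4^-1) ->
  d <= 4^-1 -> `|l%:~R * d| <= 4^-1 -> `|x - x'| <= d ->
  (forall i, (i <= n)%N -> exists m : int,
    `|curve_fiber l f alpha i x - curve_fiber l f alpha i x' + m%:~R| <= d) ->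
  forall i, (i <= n)%N ->
    `|curve_fiber l f alpha i x - curve_fiber l f alpha i x'| <= d.
Proof.
move=> fd d4 ld xx' near_int.
have jump i : (i <= n)%N ->
    `|curve_fiber l f alpha i x - curve_fiber l f alpha i x'| <= 2^-1 ->
    `|curve_fiber l f alpha i x - curve_fiber l f alpha i x'| <= d.
  move=> /near_int[m]; set D := _ - _ => hm hD.
  have m1 : `|m%:~R : R| < 1.
    rewrite (_ : m%:~R = (D + m%:~R) - D); last by ring.
    by apply: le_lt_trans (ler_normB _ _) _; lra.
  by move: hm; rewrite (normr_int_lt1 m1) addr0.
elim=> [|i IH] lein; apply: jump => //.
  rewrite /curve_fiber /birkhoff !big_ord0 !add0r -mulrBr.
  rewrite normrM; apply: (@le_trans _ _ 4^-1); last by lra.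
  apply: le_trans ld; rewrite normrM ler_wpM2l //.
  exact: le_trans xx' (ler_norm _).
have := IH (ltnW lein); rewrite !curve_fiberS => hi.
have hf : `|f (x + i%:R * alpha) - f (x' + i%:R * alpha)| <= 4^-1.
  by apply: fd; rewrite (_ : _ - _ = x - x') //; ring.
rewrite (_ : _ - _ =
  (curve_fiber l f alpha i x - curve_fiber l f alpha i x')
  + (f (x + i%:R * alpha) - f (x' + i%:R * alpha))); last by ring.
by apply: le_trans (ler_normD _ _) _; lra.
Qed.

(** The integer [m] accounts for base points that are close on the circle but
    not on the line: [x'] has to be replaced by [x' - m], which lowers
    the fibre coordinate of [T^n] by [l m (n + 1)]. *)
Lemma common_shadow_fiber (R : realType) (l : int) (f : R -> R) (alpha eps : R)
    (n : nat) (x x' : R) (v : torus R) :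
  lift_class l f -> 0 <= eps ->
  (forall a b, `|a - b| <= 2 * eps -> `|f a - f b| <= 4^-1) ->
  2 * eps <= 4^-1 -> `|l%:~R * (2 * eps)| <= 4^-1 ->
  bowen_dist (skew_product alpha f) n.+1
    (\pi_(circle R) x, \pi_(circle R) (l%:~R * x)) v <= eps ->
  bowen_dist (skew_product alpha f) n.+1
    (\pi_(circle R) x', \pi_(circle R) (l%:~R * x')) v <= eps ->
  exists m : int,
    `|curve_fiber l f alpha n x - curve_fiber l f alpha n x'
      + (l * m * n.+1)%:~R| <= 2 * eps.
Proof.
move=> hf e0 fd e4 le /(bowen_dist_leP _ _ _ _ e0) hx
  /(bowen_dist_leP _ _ _ _ e0) hx'.
have [m hm] : exists m : int, `|x - x' + m%:~R| <= 2 * eps.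
  apply/circle_dist_leP; have [h _] := hx 0%N isT; have [h' _] := hx' 0%N isT.
  exact: circle_dist_common h h'.
have shift i : curve_fiber l f alpha i (x' + (- m)%:~R) =
    curve_fiber l f alpha i x' - (l * m * i.+1)%:~R.
  by rewrite curve_fiber_lift // mulrN mulNr intrN.
exists m.
have := @curve_fiber_shadow R l f alpha (2 * eps) n x (x' + (- m)%:~R)
  fd e4 le _ _ n (leqnn n).
rewrite shift opprB [_ + (_ - _)]addrCA addrC addrAC; apply.
  by rewrite intrN opprD opprK addrA.
move=> i lein.
have [_ h] := hx i lein; have [_ h'] := hx' i lein.
have := circle_dist_common h h'; rewrite !(iter_skew_product _ _ _ _ hf) /=.
move=> /circle_dist_leP[k hk]; exists (k - l * m * i.+1).
rewrite shift intrB (_ : _ + _ = curve_fiber l f alpha i x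
  - curve_fiber l f alpha i x' + k%:~R) //; ring.
Qed.

(** Write [h] for [curve_fiber l f alpha n].  For [j < k (n + 1)] the values
    [h(0) + l j / k] are [|l| / k] apart modulo the period [l (n + 1)], while
    points with a common shadow have values within [2 eps < 1 / k] of each other
    modulo the period. *)
Lemma complexity_ge_linear (R : realType) (l : int) (f : R -> R) (alpha eps : R)
    (k n : nat) :
  l != 0 -> lift_class l f -> 0 < eps ->
  (forall a b, `|a - b| <= 2 * eps -> `|f a - f b| <= 4^-1) ->
  2 * eps <= 4^-1 -> `|l%:~R * (2 * eps)| <= 4^-1 ->
  (0 < k)%N -> 2 * eps * k%:R < 1 ->
  ((k * n.+1)%:R%:E <= complexity (skew_product alpha f) n.+1 eps)%E.
Proof.
move=> l0 hf e0 fd e4 le k0 ek.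
have kR : 0 < k%:R :> R by rewrite ltr0n.
pose h := curve_fiber l f alpha n.
have h1 : h 1 = h 0 + l%:~R * n.+1%:R.
  by rewrite /h -[1 in LHS]add0r (curve_fiber_lift _ _ _ 1 hf) mulr1 intrM.
have /choice[p hp] : forall j : 'I_(k * n.+1), exists x,
    h x = h 0 + l%:~R * (j%:R / k%:R).
  move=> j; suff [x _ hx] : exists2 x, x \in `[0, 1] &
      h x = h 0 + l%:~R * (j%:R / k%:R) by exists x.
  apply: IVT => //.
    by apply: continuous_subspaceT; apply: continuous_curve_fiber; case: hf.
  have j0 : 0 <= j%:R / k%:R :> R by rewrite divr_ge0.
  have j1 : j%:R / k%:R <= n.+1%:R :> R.
    by rewrite ler_pdivrMr // mulrC -natrM ler_nat ltnW.
  rewrite h1 ge_min le_max !lerD2l gerDl lerDl.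
  have [lp|lm] := lerP 0 (l%:~R : R).
    by apply/andP; split; apply/orP;
      [left; exact: mulr_ge0|right; exact: ler_wpM2l].
  by apply/andP; split; apply/orP;
    [right; rewrite ler_nM2l|left; rewrite nmulr_rle0].
apply: (@complexity_ge_separated _ _ _ _ _
  (fun j => (\pi_(circle R) (p j), \pi_(circle R) (l%:~R * p j)))).
move=> i j v hi hj.
have [m] := common_shadow_fiber hf (ltW e0) fd e4 le hi hj.
rewrite -!/(h _) !hp => hm.
(* [k] times the inequality [hm], whose left side becomes an integer. *)
have : `|(l * (i%:Z - j%:Z + m * (k * n.+1)%:Z))%:~R : R| < 1.
  apply: le_lt_trans ek.
  rewrite -[k%:R in leRHS]ger0_norm // -ler_pdivrMr ?normr_gt0 ?gt_eqF //.
  rewrite -normf_div; apply: le_trans hm; rewrite le_eqVlt; apply/orP; left.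
  apply/eqP; congr `|_|; rewrite PoszM !(intrM, intrD, intrN).
  by field; rewrite gt_eqF.
move=> /normr_int_lt1/eqP; rewrite mulf_eq0 (negPf l0) /= => /eqP eij.
apply/val_inj => /=.
have := ltn_ord i; have := ltn_ord j; move: eij.
move: (nat_of_ord i) (nat_of_ord j) => a b.
move: (k * n.+1)%N => N eab bN aN.
have m0 : m = 0 by nia.
by move: eab; rewrite m0; lia.
Qed.

(** * Linear growth of the complexity *)

Lemma cvg_truncn_inv3 (R : realType) :
  (Num.truncn (1 / (3 * eps)))%:R @[eps --> (0 : R)^'+] --> (+oo : set_system R).
Proof.
apply/cvgryPge => A; near=> eps.
have e0 : 0 < eps by near: eps; exact: nbhs_right_gt.
have A1 : 0 < 3 * (`|A| + 1) by rewrite mulr_gt0 // ltr_wpDl.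
have he : eps <= 1 / (3 * (`|A| + 1)).
  by near: eps; apply: nbhs_right_le; rewrite divr_gt0.
have hA : `|A| + 1 <= 1 / (3 * eps).
  move: he; rewrite !ler_pdivlMr ?mulr_gt0 //.
  by rewrite (_ : eps * _ = (`|A| + 1) * (3 * eps)) //; ring.
have := truncnS_gt (1 / (3 * eps)); rewrite -[(Num.truncn _).+1%:R]natr1 => ht.
by have := ler_norm A; lra.
Unshelve. all: by end_near. Qed.

Theorem theoremA (R : realType) (l : int) (alpha : R) (f : R -> R)
    (l_neq0 : l != 0) (alpha_irr : irrational alpha)
    (f_lift : lift_class l f) (f_bv : bounded_variation 0 1 f) :
  exists (eps0 : R) (c1 c2 : R -> R),
    [/\ 0 < eps0,
        forall eps : R, 0 < eps < eps0 ->
          [/\ 0 < c1 eps, 0 < c2 eps &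
              forall n : nat, (1 <= n)%N ->
                ((c1 eps * n%:R)%:E <= complexity (skew_product alpha f) n eps
                 <= (c2 eps * n%:R)%:E)%E] &
        c1 eps @[eps --> 0^'+] --> +oo].
Proof.
have [G [A [Gid Gf GA]]] := dominating_modulus f_lift f_bv.
have quarter : 0 < 4^-1 :> R by [].
have [d d0 fd] := lift_unif_continuous f_lift quarter.
have A0 : 0 <= A by have := Gid 0 (0 + 1); rewrite GA ler_wpDr //; lra.
have L0 : 0 < `|l%:~R : R| by rewrite normr_gt0 intr_eq0.
(* With [eps < d / 2] the modulus [d] applies to distances [2 eps]; the bounds
   [1/8] and [1 / (8 |l|)] make [2 eps] and [2 eps |l|] at most [1/4], and
   [1/8 < 1/3] makes [k = truncn (1 / (3 eps))] positive, with
   [2 eps k <= 2/3]. *)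
exists (Num.min (d / 2) (Num.min 8^-1 (8^-1 / `|l%:~R|))),
  (fun eps => (Num.truncn (1 / (3 * eps)))%:R),
  (fun eps => (A / (eps / 2) + 1) * (1 / (eps / 2) + 1)).
split; last exact: cvg_truncn_inv3.
  by rewrite !lt_min; apply/and3P; split; rewrite ?divr_gt0.
move=> eps /andP[e0]; rewrite !lt_min => /and3P[ed e8 el].
have e30 : 0 < 3 * eps by rewrite mulr_gt0.
have kgt : (0 < Num.truncn (1 / (3 * eps)))%N.
  by rewrite truncn_gt0 ler_pdivlMr //; lra.
have kle : (Num.truncn (1 / (3 * eps)))%:R * (3 * eps) <= 1.
  by rewrite -ler_pdivlMr // truncn_le divr_ge0 // ltW.
split; first by rewrite ltr0n.
  by apply: mulr_gt0; apply: ltr_wpDl => //; apply: divr_ge0 => //; lra.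
case=> // n _; apply/andP; split.
  2: exact: (complexity_le_linear alpha f_lift Gid Gf GA).
rewrite -natrM; apply: (complexity_ge_linear alpha n l_neq0 f_lift) => //.
- by move=> a b hab; apply: fd; lra.
- by lra.
- rewrite normrM (@ger0_norm _ (2 * eps)) ?mulr_ge0 ?(ltW e0) //.
  by move: el; rewrite ltr_pdivlMr //; lra.
- by set k := _%:R in kle *; lra.
Qed.
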